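(* Consider the harmonic oscillator $\dot x=y$, $\dot y=-x$, i.e. the vector field $F(x,y)=(y,-x)$ on $\mathbb{R}^2$. Given the conservation law $$H\big((\dot x,\dot y),(x,y)\big)=\tfrac12(x\dot x+y\dot y)^2,$$ the system is discoverable within the space of analytic vector fields with skew-symmetric Jacobians from any single trajectory away from the origin. That is: for every non-zero solution $u$ of $\dot u=F(u)$, $F$ is the only real analytic $G:\mathbb{R}^2\to\mathbb{R}^2$ with everywhere skew-symmetric Jacobian such that $\dot u=G(u)$ and $\nabla_vH(G(w),w)=0$ for all $w\in\mathbb{R}^2$.
   Context: $H(v,u)$ is regarded as a function of $v=(\dot x,\dot y)\in\mathbb{R}^2$ and $u=(x,y)\in\mathbb{R}^2$, and $\nabla_v$ is the gradient in the first vector argument $v$. Discoverable ''given the conservation law $H$'' means uniqueness among vector fields $G$ of the stated class that reproduce the trajectory and satisfy $\nabla_vH(G(w),w)=0$ for all $w$. *)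

(* Defs.v *)
From HB Require Import structures.
From mathcomp Require Import all_boot all_order all_algebra.
From mathcomp Require Import all_classical all_reals all_analysis.

Set Implicit Arguments.
Unset Strict Implicit.
Unset Printing Implicit Defensive.

Import Order.TTheory GRing.Theory Num.Theory.
Import numFieldNormedType.Exports.

Local Open Scope classical_set_scope.
Local Open Scope ring_scope.

Definition monomial (R : realType) (n : nat) (k : {ffun 'I_n -> nat})
  (h : 'rV[R]_n) : R := \prod_(i < n) h 0 i ^+ k i.

(* The terms c k * h^k are absolutely summable over all multi-indices k and
   their sum is s.  Given absolute summability, the sum is the limit along any
   exhaustion of the multi-indices; here the cubes {0, ..., N-1}^n are used. *)
Definition power_series_sums_to (R : realType) (n : nat)
    (c : {ffun 'I_n -> nat} -> R) (h : 'rV[R]_n) (s : R) : Prop :=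
  summable [set: {ffun 'I_n -> nat}] (fun k => (c k * monomial k h)%:E) /\
  (fun N : nat => \sum_(k : {ffun 'I_n -> 'I_N})
     c [ffun i => k i : nat] * monomial [ffun i => k i : nat] h) @ \oo --> s.

Definition real_analytic (R : realType) (n m : nat)
    (f : 'rV[R]_n -> 'rV[R]_m) : Prop :=
  forall (p : 'rV[R]_n) (j : 'I_m), exists c : {ffun 'I_n -> nat} -> R,
    \forall h \near (0 : 'rV[R]_n), power_series_sums_to c h (f (p + h) 0 j).

Definition skew_symmetric (R : realType) (n : nat) (A : 'M[R]_n) : Prop :=
  A^T = - A.

Definition gradient (R : realType) (n : nat) (f : 'rV[R]_n -> R)
  (p : 'rV[R]_n) : 'rV[R]_n := \row_(j < n) 'D_(delta_mx 0 j) f p.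

(* Nothing is required outside the time interval I; on an open I the derivative
   of u at a point of I only depends on the values of u on I. *)
Definition solves_on (R : realType) (n : nat) (I : set R)
    (G : 'rV[R]_n -> 'rV[R]_n) (u : R -> 'rV[R]_n) : Prop :=
  forall t : R, I t -> is_derive t (1 : R) u (G (u t)).

(* In 'rV[R]_2 the coordinates x and y have indices 0 and 1. *)
Definition harmonic_oscillator (R : realType) (w : 'rV[R]_2) : 'rV[R]_2 :=
  \row_(j < 2) if j == 0 then w 0 1 else - w 0 0.

Definition conserved_H (R : realType) (v u : 'rV[R]_2) : R :=
  2^-1 * (u 0 0 * v 0 0 + u 0 1 * v 0 1) ^+ 2.

(* The gradient is taken in the velocity v only, with the position fixed to w,
   and is then evaluated at v = G w. *)
Definition respects_conservation_law (R : realType) (n : nat)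
    (H : 'rV[R]_n -> 'rV[R]_n -> R) (G : 'rV[R]_n -> 'rV[R]_n) : Prop :=
  forall w : 'rV[R]_n, gradient (fun v => H v w) (G w) = 0.

(* F is the only vector field of the class C that reproduces the trajectory u
   on I and respects the conservation law H; F itself is required to be one. *)
Definition discoverable_given (R : realType) (n : nat)
    (H : 'rV[R]_n -> 'rV[R]_n -> R) (C : set ('rV[R]_n -> 'rV[R]_n))
    (I : set R) (u : R -> 'rV[R]_n) (F : 'rV[R]_n -> 'rV[R]_n) : Prop :=
  unique (fun G => [/\ C G, solves_on I G u & respects_conservation_law H G]) F.

Definition analytic_skew_jacobian (R : realType) (n : nat) :
    set ('rV[R]_n -> 'rV[R]_n) :=
  [set G | real_analytic G /\ forall w : 'rV[R]_n, skew_symmetric ('J G w)].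

(* Main.v *)
Require Import Defs.
From mathcomp Require Import all_boot all_order all_algebra.
From mathcomp Require Import all_classical all_reals all_analysis.
From mathcomp Require Import ring lra.
Import numFieldNormedType.Exports.
Import Order.TTheory GRing.Theory Num.Theory.
Local Open Scope classical_set_scope.
Local Open Scope ring_scope.

(** The conservation law says that [G] is tangent to the circles around the
    origin: the velocity gradient of [H] at [(G w, w)] is [(w . G w) w], so
    [w . G w = 0] for all [w] ([respects_conserved_HP]).

    A skew-symmetric Jacobian has zero diagonal, so the first component of [G]
    does not depend on [x] and the second does not depend on [y]
    ([skew_jacobian_coord_constant]): [G (x, y) = (a y, b x)].  Tangency becomes
    [x * a y + y * b x = 0] for all [x] and [y].  Setting [x = 1], then [y = 1],
    gives [a y = - b 1 * y] and [b x = - a 1 * x], and both at once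
    [b 1 = - a 1]; hence [G = c F] with the constant [c = a 1].  On the
    trajectory [c F (u t) = u' t = F (u t)], and [F (u t)] is non-zero as soon as
    [u t] is, so [c = 1] and [G = F].

    Analyticity yields differentiability, which is what ties the
    Jacobian matrix to the partial derivatives of [G].  An absolutely convergent
    power series agrees with its terms of degree at most one up to [M |h|^2]
    near the centre ([power_series_first_order]), whence
    [real_analytic_differentiable].  Conversely, [F] itself belongs to the class
    because it is linear with a skew-symmetric matrix, and an affine function is
    a power series with finitely many non-zero coefficients. *)

(** * Multi-indices of degree at most one *)

Definition degree {n : nat} (k : {ffun 'I_n -> nat}) : nat := \sum_(i < n) k i.

Definition unit_index {n : nat} (i : 'I_n) : {ffun 'I_n -> nat} :=
  [ffun j => (j == i) : nat].

Definition zero_index {n : nat} : {ffun 'I_n -> nat} := [ffun=> 0%N].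

Lemma degree_eq0 n (k : {ffun 'I_n -> nat}) : degree k = 0%N -> k = zero_index.
Proof.
move=> /eqP; rewrite /degree sum_nat_eq0 => /forallP k0.
by apply/ffunP => i; rewrite ffunE; exact/eqP/k0.
Qed.

Lemma degree_eq1 n (k : {ffun 'I_n -> nat}) :
  degree k = 1%N -> exists i, k = unit_index i.
Proof.
move=> /eqP /sum_nat_eq1[i [_ ki kj]]; exists i.
apply/ffunP => j; rewrite ffunE; have [->//|ji] := eqVneq j i.
exact: kj.
Qed.

Lemma degree_zero_index n : degree (@zero_index n) = 0%N.
Proof. by rewrite /degree big1 // => i _; rewrite ffunE. Qed.

Lemma degree_unit_index n (i : 'I_n) : degree (unit_index i) = 1%N.
Proof.
rewrite /degree (bigD1 i) //= ffunE eqxx big1 // => j ji.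
by rewrite ffunE (negbTE ji).
Qed.

Lemma unit_index_inj n : injective (@unit_index n).
Proof.
move=> i j /ffunP /(_ i); rewrite !ffunE eqxx.
by case: eqVneq.
Qed.

Lemma cube_index_inj n N :
  injective (fun k : {ffun 'I_n -> 'I_N} => [ffun i => k i : nat]).
Proof.
move=> k l /ffunP kl; apply/ffunP => i; apply/val_inj.
by have := kl i; rewrite !ffunE.
Qed.

(** A cube of side at least two contains every multi-index of degree at most
    one, so the constant and linear terms can be split off from the sums that
    define convergence of a power series. *)
Lemma sum_cube_first_order (V : nmodType) n N (E : {ffun 'I_n -> nat} -> V) :
  \sum_(k : {ffun 'I_n -> 'I_N.+2}) E [ffun i => k i : nat] =
  E zero_index + \sum_(i < n) E (unit_index i) +
  \sum_(k : {ffun 'I_n -> 'I_N.+2} | (1 < degree [ffun i => k i : nat])%N)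
     E [ffun i => k i : nat].
Proof.
pose m (k : {ffun 'I_n -> 'I_N.+2}) : {ffun 'I_n -> nat} :=
  [ffun i => k i : nat].
pose e (i : 'I_n) : {ffun 'I_n -> 'I_N.+2} := [ffun j => inord (j == i)].
pose z : {ffun 'I_n -> 'I_N.+2} := [ffun=> ord0].
have m_inj : injective m by exact: cube_index_inj.
have mz : m z = zero_index by apply/ffunP => i; rewrite !ffunE.
have me i : m (e i) = unit_index i.
  by apply/ffunP => j; rewrite !ffunE inordK //; case: (j == i).
have e_inj : injective e.
  by move=> i j eij; apply: (@unit_index_inj n); rewrite -!me eij.
rewrite (bigID (fun k => degree (m k) <= 1)%N) /=; congr (_ + _); last first.
  by apply: eq_bigl => k; rewrite -ltnNge.
rewrite (bigD1 z) /=; last by rewrite mz degree_zero_index.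
rewrite -/(m z) mz; congr (_ + _).
under [RHS]eq_bigr do rewrite -me.
rewrite -(big_imset (h := e) (A := 'I_n) (fun k => E (m k))) /=; last first.
  by move=> i j _ _; exact: e_inj.
apply: eq_bigl => k; apply/andP/imsetP => [[k1 kz]|[i _ ->]]; last first.
  rewrite me degree_unit_index; split=> //; apply/eqP => eiz.
  by have := degree_unit_index _ i; rewrite -me eiz mz degree_zero_index.
have [i mk] : exists i, m k = unit_index i.
  apply: degree_eq1; move: k1; rewrite leq_eqVlt ltnS leqn0 => /orP[/eqP //|/eqP].
  by move=> /degree_eq0; rewrite -mz => /m_inj zk; rewrite zk eqxx in kz.
by exists i => //; apply: m_inj; rewrite mk me.
Qed.

(** * Power series and their first-order part *)

Section monomials.
Context {R : realType} {n : nat}.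
Implicit Types (h : 'rV[R]_n) (k : {ffun 'I_n -> nat}).

Lemma monomial_zero_index h : monomial zero_index h = 1.
Proof. by rewrite /monomial big1 // => i _; rewrite ffunE expr0. Qed.

Lemma monomial_unit_index h (i : 'I_n) : monomial (unit_index i) h = h 0 i.
Proof.
rewrite /monomial (bigD1 i) //= ffunE eqxx expr1 big1 ?mulr1 // => j ji.
by rewrite ffunE (negbTE ji) expr0.
Qed.

Lemma monomial_const k (r : R) : monomial k (const_mx r) = r ^+ degree k.
Proof.
rewrite /monomial /degree expr_sum.
by apply: eq_bigr => i _; rewrite mxE.
Qed.

Lemma coord_le_norm h i : `|h 0 i| <= `|h|.
Proof.
rewrite [leRHS]/Num.Def.normr /= mx_normrE.
exact: (le_bigmax _ (fun ij : 'I_1 * 'I_n => `|h ij.1 ij.2|) (0, i)).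
Qed.

Lemma monomial_le_norm k h : `|monomial k h| <= `|h| ^+ degree k.
Proof.
rewrite /monomial /degree normr_prod expr_sum; apply: ler_prod => i _.
by rewrite normrX exprn_ge0 //= lerXn2r ?nnegrE // coord_le_norm.
Qed.

End monomials.

Lemma summable_sum_le (R : realType) (T : choiceType) (a : T -> R) :
  summable [set: T] (fun x => (a x)%:E) ->
  exists S : R, forall (J : finType) (f : J -> T), injective f ->
    \sum_j `|a (f j)| <= S.
Proof.
move=> sa; exists (fine (\esum_(x in [set: T]) `|(a x)%:E|)%E) => J f f_inj.
rewrite -lee_fin fineK; last by rewrite -summableE.
apply: esum_ge; exists [set` [seq f j | j <- enum J]] => //.
rewrite -fsbig_seq; last by rewrite map_inj_uniq ?enum_uniq.
by rewrite big_map big_enum /= -sumEFin.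
Qed.

Lemma summable_finite_support (R : realType) (T : choiceType) (D : set T)
    (a : T -> R) : finite_set D -> (forall x, ~ D x -> a x = 0) ->
  summable [set: T] (fun x => (a x)%:E).
Proof.
move=> finD a0; rewrite /summable.
rewrite (_ : (\esum_(x in [set: T]) _)%E =
             (\esum_(x in D) `|(a x)%:E|)%E); last first.
  rewrite [RHS]esum_mkcond; apply: eq_esum => x _.
  by case: ifPn => // /negP; rewrite inE => /a0 ->; rewrite abse0.
by rewrite esum_fset // fsumEFin // ltry.
Qed.

(** Absolute convergence at the point [(s, ..., s)] bounds all
    [`|c k| * s ^+ degree k] by one convergent sum.  When [`|h| <= s], a term of
    degree at least two at [h] is at most [(`|h| / s) ^+ 2] times the
    corresponding term at [(s, ..., s)], so the remainder is quadratic
    in [`|h|]. *)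
Lemma power_series_first_order (R : realType) n
    (c : {ffun 'I_n -> nat} -> R) (g : 'rV[R]_n -> R) :
  (\forall h \near (0 : 'rV[R]_n), power_series_sums_to c h (g h)) ->
  exists M : R, \forall h \near (0 : 'rV[R]_n),
    `|g h - (c zero_index + \sum_(i < n) c (unit_index i) * h 0 i)|
      <= M * `|h| ^+ 2.
Proof.
move=> /nbhs_ballP[r /= r0 rP].
have rP' h : `|h| < r -> power_series_sums_to c h (g h).
  by move=> hr; apply: rP; rewrite -ball_normE /= sub0r normrN.
(* Any [s] strictly between 0 and the radius [r] would do. *)
pose s := r / 2.
have s0 : 0 < s by rewrite divr_gt0.
have sr : `|const_mx s : 'rV[R]_n| < r.
  rewrite [ltLHS]/Num.Def.normr /= mx_normrE; apply: bigmax_lt => //= ij _.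
  by rewrite mxE gtr0_norm // /s ltr_pdivrMr // ltr_pMr // ltr1n.
have [S HS] := summable_sum_le _ _ _ (rP' _ sr).1.
exists (S / s ^+ 2); near=> h.
have hs : `|h| <= s by near: h; exact: (@nbhs0_le R 'rV[R]_n).
have hr : `|h| < r.
  by apply: le_lt_trans hs _; rewrite /s ltr_pdivrMr // ltr_pMr // ltr1n.
pose L := c zero_index + \sum_(i < n) c (unit_index i) * h 0 i.
have cvgh : `|\sum_(k : {ffun 'I_n -> 'I_N}) c [ffun i => k i : nat] *
    monomial [ffun i => k i : nat] h - L| @[N --> \oo] --> `|g h - L|.
  by apply: cvg_norm; apply: cvgB (rP' _ hr).2 (cvg_cst L).
apply: (ler_cvg_to cvgh (cvg_cst _)).
exists 2%N => // -[|[|N]] // _.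
rewrite /= (sum_cube_first_order _ _ _ (fun k => c k * monomial k h)).
rewrite monomial_zero_index mulr1.
under [X in _ + X + _ - _]eq_bigr do rewrite monomial_unit_index.
rewrite -/L addrAC subrr add0r (le_trans (ler_norm_sum _ _ _)) //.
pose m (k : {ffun 'I_n -> 'I_N.+2}) : {ffun 'I_n -> nat} :=
  [ffun i => k i : nat].
have m_inj : injective m by exact: cube_index_inj.
have {}HS := HS _ m m_inj.
rewrite mulrAC -mulrA.
(* The terms of degree at most one at [(s, ..., s)] are added back here: the
   bound [S] is on the sum over the whole cube. *)
apply: (@le_trans _ _ ((\sum_k `|c (m k) * monomial (m k) (const_mx s)|)
                       * (`|h| ^+ 2 / s ^+ 2))); last first.
  by apply: ler_wpM2r HS; rewrite divr_ge0 // exprn_ge0 // ltW.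
rewrite mulr_suml [leRHS](bigID (fun k => 1 < degree (m k))%N) /=.
rewrite -[leLHS]addr0 lerD //; last first.
  by apply: sumr_ge0 => k _; rewrite mulr_ge0 // divr_ge0 // exprn_ge0 // ltW.
apply: ler_sum => k dk; rewrite -/(m k) !normrM -mulrA ler_wpM2l //.
apply: le_trans (monomial_le_norm _ _) _.
rewrite monomial_const ger0_norm; last by rewrite exprn_ge0 // ltW.
rewrite -(subnKC dk) !exprD [leRHS](_ : _ = `|h| ^+ 2 * s ^+ (degree (m k) - 2)).
  by rewrite ler_wpM2l ?exprn_ge0 // lerXn2r ?nnegrE // ltW.
by field; rewrite gt_eqF.
Unshelve. all: by end_near. Qed.

(** * Differentiability of analytic maps *)

Lemma rV_norm_le (R : realType) n (v : 'rV[R]_n) (e : R) :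
  0 <= e -> (forall j, `|v 0 j| <= e) -> `|v| <= e.
Proof.
move=> e0 ve; rewrite [leLHS]/Num.Def.normr /= mx_normrE.
by apply: bigmax_le => // -[i j] _ /=; rewrite ord1.
Qed.

Lemma mulmxr_continuous (R : realType) n m (A : 'M[R]_(n, m)) :
  continuous (mulmxr A : 'rV[R]_n -> 'rV[R]_m).
Proof.
apply: bounded_linear_continuous; apply/linear_boundedP.
exists (\sum_j \sum_i `|A i j|); split; first exact: num_real.
move=> M /ltW SM v; apply: le_trans (_ : _ <= (\sum_j \sum_i `|A i j|) * `|v|) _.
  apply: rV_norm_le => [|j].
    by rewrite mulr_ge0 // sumr_ge0 // => j _; rewrite sumr_ge0.
  rewrite mxE (le_trans (ler_norm_sum _ _ _)) //.
  apply: (@le_trans _ _ ((\sum_i `|A i j|) * `|v|)).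
    rewrite mulr_suml; apply: ler_sum => i _.
    by rewrite normrM mulrC ler_wpM2l // coord_le_norm.
  rewrite ler_wpM2r // (bigD1 j) //= lerDl sumr_ge0 // => k _.
  by rewrite sumr_ge0.
by rewrite ler_wpM2r.
Qed.

(** The linear coefficients of the components' power series form the matrix of
    the differential, the remainder being quadratic in each component. *)
Lemma real_analytic_differentiable (R : realType) n m
    (f : 'rV[R]_n -> 'rV[R]_m) (p : 'rV[R]_n) :
  real_analytic f -> differentiable f p.
Proof.
move=> f_an.
have /choice[cM cMP] : forall j, exists cM : ({ffun 'I_n -> nat} -> R) * R,
    \forall h \near (0 : 'rV[R]_n),
      `|f (p + h) 0 j - (cM.1 zero_index +
        \sum_(i < n) cM.1 (unit_index i) * h 0 i)| <= cM.2 * `|h| ^+ 2.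
  move=> j; have [c /power_series_first_order[M cM]] := f_an p j.
  by exists (c, M).
pose A : 'M[R]_(n, m) := \matrix_(i, j) (cM j).1 (unit_index i).
have fp j : f p 0 j = (cM j).1 zero_index.
  have /nbhs_singleton := cMP j; rewrite addr0 normr0 expr0n mulr0.
  rewrite big1; last by move=> i _; rewrite mxE mulr0.
  by rewrite addr0 normr_le0 subr_eq0 => /eqP.
have dA : f \o shift p = cst (f p) + (mulmxr A : 'rV[R]_n -> _) +o_ (0 : 'rV[R]_n) id.
  apply/eqaddoP => e e0; near=> h.
  have hM j : `|f (p + h) 0 j - ((cM j).1 zero_index +
      \sum_(i < n) (cM j).1 (unit_index i) * h 0 i)| <= (cM j).2 * `|h| ^+ 2.
    by move: j; near: h; exact: filter_forall.
  have h_small j : `|h| <= e / (`|(cM j).2| + 1).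
    move: j; near: h; apply: filter_forall => j.
    by apply: (@nbhs0_le R 'rV[R]_n); rewrite divr_gt0 // ltr_wpDl.
  rewrite /= -[X in `|X|]/(f (h + p) - (f p + h *m A)).
  apply: rV_norm_le => [|j]; first by rewrite mulr_ge0 // ltW.
  rewrite !mxE fp addrC [h + p]addrC addrC.
  under eq_bigr do rewrite mxE mulrC.
  apply: le_trans (hM j) _.
  apply: (@le_trans _ _ (`|(cM j).2| * `|h| ^+ 2)).
    by rewrite ler_wpM2r ?exprn_ge0 // ler_norm.
  rewrite expr2 mulrA ler_wpM2r //.
  apply: (@le_trans _ _ ((`|(cM j).2| + 1) * `|h|)).
    by rewrite ler_wpM2r // lerDl.
  by rewrite mulrC -ler_pdivlMr ?ltr_wpDl.
have dE := diff_unique (@mulmxr_continuous R n m A) dA.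
by apply/diff_locallyP; rewrite dE; split => //; exact: mulmxr_continuous.
Unshelve. all: by end_near. Qed.

Lemma jacobian_mulmxr (R : realType) n m (A : 'M[R]_(n, m)) p :
  'J (mulmxr A) p = A.
Proof.
rewrite /jacobian diff_lin; last exact: mulmxr_continuous.
by apply/row_matrixP => i; rewrite !rowE mul_rV_lin1.
Qed.

(** * Linear maps are analytic *)

Lemma affine_power_series (R : realType) n (a : R) (b : 'I_n -> R) :
  exists c : {ffun 'I_n -> nat} -> R, forall h : 'rV[R]_n,
    power_series_sums_to c h (a + \sum_(i < n) b i * h 0 i).
Proof.
pose c (k : {ffun 'I_n -> nat}) : R :=
  (k == zero_index)%:R * a + \sum_(i < n) (k == unit_index i)%:R * b i.
have cz : c zero_index = a.
  rewrite /c eqxx mul1r big1 ?addr0 // => i _; case: eqP => [/(congr1 degree)|].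
    by rewrite degree_zero_index degree_unit_index.
  by rewrite mul0r.
have cu i : c (unit_index i) = b i.
  rewrite /c (bigD1 i) //= eqxx mul1r big1 ?addr0 => [|j ji].
    case: eqP => [/(congr1 degree)|]; last by rewrite mul0r add0r.
    by rewrite degree_zero_index degree_unit_index.
  by case: eqP => [/unit_index_inj ij|]; [rewrite ij eqxx in ji|rewrite mul0r].
have c0 k : ~ (degree k <= 1)%N -> c k = 0.
  move=> dk; rewrite /c big1 => [|i _].
    by case: eqP => [kz|]; [rewrite kz degree_zero_index in dk|rewrite mul0r addr0].
  by case: eqP => [kz|]; [rewrite kz degree_unit_index in dk|rewrite mul0r].
exists c => h; split.
  apply: (@summable_finite_support _ _ ([set zero_index] `|` range (@unit_index n))).
    by rewrite finite_setU; split; [exact: finite_set1|exact: finite_image].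
  move=> k kP; rewrite c0 ?mul0r //.
  rewrite leq_eqVlt ltnS leqn0 => /orP[/eqP/degree_eq1[i ki]|/eqP/degree_eq0 k0].
    by apply: kP; right; exists i.
  by apply: kP; left.
apply: cvg_near_cst; exists 2%N => // -[|[|N]] // _ /=.
rewrite (sum_cube_first_order _ _ _ (fun k => c k * monomial k h)).
rewrite monomial_zero_index mulr1 cz.
under [X in _ + X + _]eq_bigr do rewrite monomial_unit_index cu.
by rewrite [X in _ + X]big1 ?addr0 // => k; rewrite ltnNge => /negP ?; rewrite c0 ?mul0r.
Qed.

Lemma real_analytic_mulmxr (R : realType) n m (A : 'M[R]_(n, m)) :
  real_analytic (mulmxr A : 'rV[R]_n -> 'rV[R]_m).
Proof.
move=> p j; have [c cP] := affine_power_series _ _ ((p *m A) 0 j) (fun i => A i j).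
exists c; near=> h.
rewrite (_ : mulmxr A (p + h) 0 j = (p *m A) 0 j + \sum_(i < n) A i j * h 0 i) //.
rewrite /= mulmxDl mxE; congr (_ + _); rewrite mxE.
by apply: eq_bigr => i _; rewrite mulrC.
Unshelve. all: by end_near. Qed.

(** * Vector fields with skew-symmetric Jacobian *)

Lemma constant_along (R : realType) (V : normedModType R) (g : V -> R) (v : V) :
  (forall w, is_derive w v g 0) -> forall a t, g (t *: v + a) = g a.
Proof.
move=> dg a t; rewrite -[in RHS](add0r a) -[in RHS](scale0r v).
apply: (@is_derive_0_is_cst _ (fun s : R => g (s *: v + a))) => s.
have [dgs gs] := dg (s *: v + a).
have E : (fun h : R => h^-1 *: (((fun s : R => g (s *: v + a)) \o shift s) (h *: 1)
             - g (s *: v + a))) =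
         (fun h : R => h^-1 *: ((g \o shift (s *: v + a)) (h *: v) - g (s *: v + a))).
  by apply/funext => h /=; rewrite [h *: 1]mulr1 scalerDl addrA.
by split; rewrite /derivable /derive E.
Qed.

(** The diagonal entry [j] of a skew-symmetric matrix is its own opposite, so
    the partial derivative of [G_j] in direction [j] vanishes. *)
Lemma skew_jacobian_coord_constant (R : realType) n (G : 'rV[R]_n -> 'rV[R]_n) :
  analytic_skew_jacobian G -> forall (j : 'I_n) w t,
  G (t *: delta_mx 0 j + w) 0 j = G w 0 j.
Proof.
move=> [G_an G_skew] j w t; apply: (@constant_along R _ (fun w => G w 0 j)) => {}w.
have dG : derivable G w (delta_mx 0 j).
  by apply/diff_derivable/real_analytic_differentiable.
split; first exact: (derivable_mxP _ _ _).1 dG 0 j.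
have := deriveEjacobian (delta_mx 0 j) (real_analytic_differentiable _ _ _ G w G_an).
rewrite derive_mx // -rowE => /matrixP /(_ 0 j); rewrite !mxE => ->.
have /matrixP /(_ j j) := G_skew w; rewrite !mxE => JN.
lra.
Qed.

(** * The harmonic oscillator and its conservation law *)

Lemma ord2_ind (P : 'I_2 -> Prop) : P 0 -> P 1 -> forall j, P j.
Proof.
move=> P0 P1 [[|[|//]] j2].
  by rewrite (_ : Ordinal j2 = 0) //; exact: val_inj.
by rewrite (_ : Ordinal j2 = 1) //; exact: val_inj.
Qed.

Lemma sum_ord2 (V : nmodType) (E : 'I_2 -> V) : \sum_i E i = E 0 + E 1.
Proof.
rewrite !big_ord_recl big_ord0 addr0; congr (E _ + E _); exact: val_inj.
Qed.

Lemma is_derive_conserved_H (R : realType) (a w v : 'rV[R]_2) :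
  is_derive a v (fun a => conserved_H a w)
    ((w 0 0 * a 0 0 + w 0 1 * a 0 1) * (w 0 0 * v 0 0 + w 0 1 * v 0 1)).
Proof.
have dcoord (i : 'I_2) : is_derive a v (fun a : 'rV[R]_2 => a 0 i) (v 0 i).
  have id_deriv : derivable (@id 'rV[R]_2) a v by exact: derivable_id.
  split; first exact: (derivable_mxP _ _ _).1 id_deriv 0 i.
  have := derive_mx id_deriv; rewrite derive_id.
  by move=> /matrixP /(_ 0 i); rewrite mxE.
rewrite (_ : (fun a => _) = 2^-1 *: ((w 0 0 *: (fun a : 'rV[R]_2 => a 0 0) +
   w 0 1 *: (fun a : 'rV[R]_2 => a 0 1)) ^+ 2)); last first.
  by apply/funext => b; rewrite /conserved_H !fctE.
apply: is_derive_eq; rewrite !fctE /= /GRing.scale /=.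
by field.
Qed.

(** The gradient is [(w . G w) *: w], which vanishes exactly when its scalar
    factor does: if [w = 0], the factor is zero as well. *)
Lemma respects_conserved_HP (R : realType) (G : 'rV[R]_2 -> 'rV[R]_2) :
  respects_conservation_law (@conserved_H R) G <->
  forall w : 'rV[R]_2, w 0 0 * G w 0 0 + w 0 1 * G w 0 1 = 0.
Proof.
have gradE (w : 'rV[R]_2) : gradient (fun v => conserved_H v w) (G w) =
    (w 0 0 * G w 0 0 + w 0 1 * G w 0 1) *: w.
  apply/rowP => j; rewrite !mxE (@derive_val _ _ _ _ _ _ _ (is_derive_conserved_H _ _ _ _)).
  congr (_ * _); rewrite !mxE /=.
  by elim/ord2_ind: j; rewrite /= !(mulr1, mulr0, addr0, add0r).
split=> GP w; last by rewrite gradE GP scale0r.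
have := GP w; rewrite gradE => /eqP; rewrite scaler_eq0 => /orP[/eqP //|/eqP ->].
by rewrite !mxE !mul0r addr0.
Qed.

Lemma harmonic_oscillator_mulmxr (R : realType) :
  exists2 A : 'M[R]_2, skew_symmetric A & @harmonic_oscillator R = mulmxr A.
Proof.
exists (delta_mx 1 0 - delta_mx 0 1).
  by rewrite /skew_symmetric linearB /= !trmx_delta opprB.
apply/funext => w; apply/rowP => j.
rewrite !mxE sum_ord2 !mxE.
by elim/ord2_ind: j => /=; ring.
Qed.

Theorem corollary6p7 (R : realType) (I : set R) (u : R -> 'rV[R]_2)
    (oI : open I) (itvI : is_interval I)
    (u_sol : solves_on I (@harmonic_oscillator R) u)
    (u_neq0 : exists2 t : R, I t & u t != 0) :
  discoverable_given (@conserved_H R) (@analytic_skew_jacobian R 2) I u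
    (@harmonic_oscillator R).
Proof.
split.
  split => //.
    have [A skewA ->] := harmonic_oscillator_mulmxr R.
    split; first exact: real_analytic_mulmxr.
    by move=> w; rewrite jacobian_mulmxr.
  by apply/respects_conserved_HP => w; rewrite !mxE /= mulrN [w 0 1 * _]mulrC subrr.
move=> G [G_class G_sol /respects_conserved_HP G_orth].
have wE (w : 'rV[R]_2) : w = w 0 0 *: delta_mx 0 0 + w 0 1 *: delta_mx 0 1.
  by rewrite {1}[w]row_sum_delta sum_ord2.
(* [a] and [b] are the components of [G] on the axes; by [GaE] and [GbE] they
   give those components everywhere. *)
pose a (y : R) : R := G (y *: delta_mx 0 1) 0 0.
pose b (x : R) : R := G (x *: delta_mx 0 0) 0 1.
have GaE x y : G (x *: delta_mx 0 0 + y *: delta_mx 0 1) 0 0 = a y.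
  exact: skew_jacobian_coord_constant.
have GbE x y : G (x *: delta_mx 0 0 + y *: delta_mx 0 1) 0 1 = b x.
  by rewrite addrC; exact: skew_jacobian_coord_constant.
have ab x y : x * a y + y * b x = 0.
  have := G_orth (x *: delta_mx 0 0 + y *: delta_mx 0 1).
  by rewrite GaE GbE !mxE /= !mulr1 !mulr0 addr0 add0r.
have GE w : G w = a 1 *: harmonic_oscillator w.
  have b1 : b 1 = - a 1 by have := ab 1 1; lra.
  have ay y : a y = a 1 * y by have := ab 1 y; rewrite b1; lra.
  have bx x : b x = a 1 * - x by have := ab x 1; lra.
  apply/rowP => j; rewrite !mxE [in LHS](wE w).
  by elim/ord2_ind: j; rewrite (GaE, GbE) (ay, bx).
have [t It ut] := u_neq0.
have [_ Fu] := u_sol t It; have [_ Gu] := G_sol t It.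
have : (a 1 - 1) *: harmonic_oscillator (u t) = 0.
  by rewrite scalerBl scale1r -GE -Gu Fu subrr.
move=> /eqP; rewrite scaler_eq0 subr_eq0 => /orP[/eqP a1|/eqP/rowP F0].
  by apply/funext => w; rewrite GE a1 scale1r.
case/eqP: ut; apply/rowP; have := F0 1; have := F0 0; rewrite !mxE /= => y0 x0.
by elim/ord2_ind; rewrite mxE //; lra.
Qed.
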